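(* Let $-1<a<1$ and $0<w<1$, and define $$H_{a,w}(z)=w\frac{1+z}{1-z}+(1-w)\frac{1+az}{1-az},\qquad F_{a,w}=\frac{H_{a,w}-1}{H_{a,w}+1}.$$ Then $F_{a,w}$ is a non-inner Schur function satisfying $F_{a,w}(0)=0$ and $F_{a,w}(1)=1$, and $\mathcal R(F_{a,w})>0$. More explicitly, put $$q=1-w+aw,\qquad b=a+w-aw,\qquad d=w(1-w)(1-a)^2.$$ Then $$F_{a,w}(z)=z\frac{b-az}{1-qz},\qquad [z]F_{a,w}=b,\qquad [z^n]F_{a,w}=dq^{n-2}\quad(n\ge2),$$ and $$\mathcal R(F_{a,w})=\frac{P(a,w)}{w^2(2-w+aw)^5},$$ where \begin{align*} P(a,w)={}&a^7(3w^7-3w^6)+a^6(-16w^7+39w^6-23w^5)\\ &+a^5(35w^7-136w^6+165w^5-63w^4)\\ &+a^4(-40w^7+214w^6-396w^5+295w^4-68w^3)\\ &+a^3(25w^7-171w^6+428w^5-472w^4+214w^3-14w^2)\\ &+a^2(-8w^7+67w^6-213w^5+312w^4-204w^3+50w^2+6w)\\ &+a(w^7-10w^6+39w^5-73w^4+60w^3-8w^2-2w-2)\\ &+w^4-2w^3+4w^2-4w+2. \end{align*}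
   Context: A Schur function is an analytic function $F$ on the unit disk $\mathbb D$ with $|F|\le1$; it is inner if its boundary values have modulus one almost everywhere. $[z^n]F$ denotes the $n$-th Taylor coefficient at $0$. For $F$ analytic in a neighborhood of $\overline{\mathbb D}$, put $G(z)=zF'(z)$ and define $$\mathcal R(F)=\left.\frac1{4\pi}\int_0^{2\pi}\bigl(1-\mathrm{Re}\,F(re^{i\theta})\bigr)\,\partial_r\bigl|G(re^{i\theta})\bigr|^2\,d\theta\right|_{r=1}.$$ *)

(* Defs.v *)
From HB Require Import structures.
From mathcomp Require Import all_boot all_order all_algebra.
From mathcomp Require Import complex.
From mathcomp Require Import all_classical all_reals all_analysis.

Set Implicit Arguments.
Unset Strict Implicit.
Unset Printing Implicit Defensive.

Import Order.TTheory GRing.Theory Num.Theory.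
Import numFieldNormedType.Exports.

Local Open Scope classical_set_scope.
Local Open Scope complex_scope.
Local Open Scope ring_scope.

(* The concrete type [R[i]] comes without the topology and normed-module
   structure that every [numFieldType] carries over itself. *)
HB.instance Definition _ (R : realType) :=
  NormedModule.copy R[i] (R[i] : numFieldType).

Section Disk.
Variable R : realType.
Implicit Types (F f : R[i] -> R[i]) (z : R[i]) (r t : R).

Definition unit_disk : set R[i] := [set z | `|z| < 1].
Definition closed_unit_disk : set R[i] := [set z | `|z| <= 1].

(* [derivable] over the base field [R[i]] is complex differentiability. *)
Definition analytic_on (U : set R[i]) F : Prop :=
  forall z, U z -> derivable F z 1.

Definition analytic_near_closed_disk F : Prop :=
  exists U : set R[i],
    [/\ open U, closed_unit_disk `<=` U & analytic_on U F].

Definition schur F : Prop :=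
  analytic_on unit_disk F /\ forall z, unit_disk z -> `|F z| <= 1.

Definition polar r t : R[i] := r%:C * (cos t +i* sin t).

(* Boundary values are radial limits. *)
Definition inner F : Prop :=
  schur F /\
  {ae (@lebesgue_measure R), forall t, t \in `[0, 2 * pi] ->
     exists2 l : R[i], F (polar r t) @[r --> 1^'-] --> l & `|l| = 1}.

Definition taylor_coef n F : R[i] := (derive1n n F) 0 / (n`!)%:R.

Definition zderiv F z : R[i] := z * (derive1 F) z.

Definition radial_functional F r : R :=
  (4 * pi)^-1 * \int[@lebesgue_measure R]_(t in `[0, 2 * pi])
    ((1 - complex.Re (F (polar r t))) *
     derive1 (fun s : R => ComplexField.Normc.normc (zderiv F (polar s t)) ^+ 2) r).

Definition calR F : R := radial_functional F 1.

(* Division by zero is total, so an expression such as [Haw a w z] has an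
   arbitrary value at a pole. [remove_sing] replaces every value by the limit
   over the punctured neighborhood: by [remove_sing_id] this changes nothing at
   points of continuity, and it fills in removable singularities. *)
Definition remove_sing f z : R[i] := lim (f y @[y --> z^']).

Lemma remove_sing_id f z : {for z, continuous f} -> remove_sing f z = f z.
Proof.
move=> cf; apply/cvg_lim; first exact: norm_hausdorff.
by apply: cvg_within_filter.
Qed.

Definition Haw (a w : R) z : R[i] :=
  w%:C * ((1 + z) / (1 - z)) +
  (1 - w)%:C * ((1 + a%:C * z) / (1 - a%:C * z)).

(* [Haw a w] has a pole at 1 (and at 1/a), where the quotient has a removable
   singularity. *)
Definition Faw (a w : R) : R[i] -> R[i] :=
  remove_sing (fun z => (Haw a w z - 1) / (Haw a w z + 1)).

Definition Paw (a w : R) : R :=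
  a ^+ 7 * (3 * w ^+ 7 - 3 * w ^+ 6)
  + a ^+ 6 * (- 16 * w ^+ 7 + 39 * w ^+ 6 - 23 * w ^+ 5)
  + a ^+ 5 * (35 * w ^+ 7 - 136 * w ^+ 6 + 165 * w ^+ 5 - 63 * w ^+ 4)
  + a ^+ 4 * (- 40 * w ^+ 7 + 214 * w ^+ 6 - 396 * w ^+ 5 + 295 * w ^+ 4
              - 68 * w ^+ 3)
  + a ^+ 3 * (25 * w ^+ 7 - 171 * w ^+ 6 + 428 * w ^+ 5 - 472 * w ^+ 4
              + 214 * w ^+ 3 - 14 * w ^+ 2)
  + a ^+ 2 * (- 8 * w ^+ 7 + 67 * w ^+ 6 - 213 * w ^+ 5 + 312 * w ^+ 4
              - 204 * w ^+ 3 + 50 * w ^+ 2 + 6 * w)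
  + a * (w ^+ 7 - 10 * w ^+ 6 + 39 * w ^+ 5 - 73 * w ^+ 4 + 60 * w ^+ 3
         - 8 * w ^+ 2 - 2 * w - 2)
  + w ^+ 4 - 2 * w ^+ 3 + 4 * w ^+ 2 - 4 * w + 2.

End Disk.

(* Main.v *)
Require Import Defs.
From HB Require Import structures.
From mathcomp Require Import all_boot all_order all_algebra.
From mathcomp Require Import ring lra.
From mathcomp Require Import complex.
From mathcomp Require Import all_classical all_reals all_analysis.
Import Order.TTheory GRing.Theory Num.Theory.
Import numFieldNormedType.Exports.
Local Open Scope classical_set_scope.
Local Open Scope complex_scope.
Local Open Scope ring_scope.

(** Clearing denominators in the Cayley transform of [Haw a w] leaves a rational
function with one pole. With [q := 1 - w + a * w] and [v := (1 - w) * (1 - a)],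
   [F z = z - v * (z * (1 - z) / (1 - q * z))],
and [|q| < 1] puts the pole [1 / q] outside the closed disk. Analyticity near
the closed disk, the values at 0 and 1 and the Taylor coefficients are read off
this formula ([Faw_frac], [derive1n_onepole]).

Over the denominator [1 - q z], the numerator of [F z] is [z (b - a z)] with
[b := a + w - a * w]. The gap [|1 - q z|^2 - |z (b - a z)|^2] between the
squared moduli is
   [w (1 - |z|^2) |1 - a z|^2 + (1 - w) (1 - a^2 |z|^2) |1 - z|^2]
([schur_gap]). It is nonnegative in the disk, so that [F] is a Schur function,
and on the circle it vanishes only at [z = 1], so that [|F| < 1] on a set of
positive measure and [F] is not inner.

For the boundary functional put [G z := z F'(z)] and [H z := z G'(z)]. On the
circle the conjugate of [z] is [1 / z], so twice the integrand is
   [(2 - F z - F (1/z)) (G (1/z) H z + G z H (1/z))].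
This is a rational function invariant under [z |-> 1/z] and without poles on the
circle, so it splits as [h z + h (1/z)] where [h] collects the poles outside the
closed disk ([herglotz_identity], which exhibits [h] up to the constant factor
[herglotz_den q]). The integrand is therefore the real part of [h], analytic
near the closed disk, and its mean is [h 0] by the mean value property
([mean_value]), so that the functional is half of [h 0] ([calR_onepole]).
Expanding this in [a] and [w] yields the stated fraction. Its numerator is
positive because [128 * Paw a w] is a combination of squares and constants whose
weights are monomials in the positive numbers [1 + a], [1 - a], [w] and [1 - w]
with positive coefficients ([Paw_gt0]). *)

Set Implicit Arguments.
Unset Strict Implicit.
Unset Printing Implicit Defensive.

(** * Rational functions with one pole *)

Section OnePole.
Variable K : numFieldType.
Implicit Types q v z e : K.

Lemma near_pole_free q z : 1 - q * z != 0 -> \forall y \near z, 1 - q * y != 0.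
Proof.
move=> qz; apply: (@cvgr_neq0 _ _ _ (nbhs z) _ (fun y => 1 - q * y) _ _ qz).
by apply: cvgB; [exact: cvg_cst|apply: cvgMr; exact: cvg_id].
Qed.

Lemma open_pole_free q : open [set z | 1 - q * z != 0].
Proof. by rewrite openE => z; exact: near_pole_free. Qed.

(** When [z] is itself the pole, [1 - q * y] equals [q * (z - y)] and vanishes
only at [y = z]. Limits over a punctured neighborhood may thus be computed away
from the poles, whatever [z] is. *)
Lemma near_punctured_pole_free q z : \forall y \near z^', 1 - q * y != 0.
Proof.
have [qz|qz] := eqVneq (1 - q * z) 0; last exact/cvg_within/near_pole_free.
near=> y.
have yz : y != z by near: y; exact: nbhs_dnbhs_neq.
apply: contra_neq yz => qy.
have q0 : q != 0.
  by apply: contra_eq_neq qz => ->; rewrite mul0r subr0 oner_neq0.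
by apply: (mulfI q0); rewrite -[q * y](subKr 1) -[q * z](subKr 1) qy qz.
Unshelve. all: by end_near. Qed.

Lemma scalerE_regular (x y : K) : x *: y = x * y. Proof. by []. Qed.

Lemma is_derive_geom q z e : 1 - q * z != 0 ->
  is_derive z e (fun y => (1 - q * y)^-1) (q * e / (1 - q * z) ^+ 2).
Proof.
move=> qz.
have d1 : is_derive z e (fun y => 1 - q * y) (- (q * e)).
  have -> : (fun y => 1 - q * y) = cst 1 - q *: id by [].
  by apply: is_derive_eq; rewrite sub0r.
apply: DeriveDef; first exact: derivableV.
by rewrite deriveV// derive_val scaleNr scalerN opprK [LHS]mulrC.
Qed.

Lemma is_derive_geomX q c n z e : 1 - q * z != 0 ->
  is_derive z e (fun y => c / (1 - q * y) ^+ n)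
    (n%:R * c * q / (1 - q * z) ^+ n.+1 * e).
Proof.
move=> qz; have du := is_derive_geom e qz.
have -> : (fun y => c / (1 - q * y) ^+ n) = c *: (fun y => (1 - q * y)^-1) ^+ n.
  by apply/funext => y; rewrite !fctE exprVn.
apply: (is_derive_eq (is_deriveZ _ (is_deriveX _ du))).
rewrite !scalerE_regular; case: n => [|n]/=; first by rewrite !mul0r mulr0.
by rewrite exprVn !exprS; field; rewrite qz expf_neq0.
Qed.

(** The functions [F] of the theorem, in the parameters that keep the formulas
short: [q] locates the pole, and [v] measures the deviation from the inner
function [z |-> z], to which [F] degenerates at [v = 0]. *)
Definition onepole q v z := z - v * (z * (1 - z) / (1 - q * z)).

Definition onepole1 q v z :=
  1 - v * ((1 - 2 * z + q * z ^+ 2) / (1 - q * z) ^+ 2).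

Definition onepole2 q v z := 2 * (1 - q) * v / (1 - q * z) ^+ 3.

Lemma is_derive_onepole q v z e : 1 - q * z != 0 ->
  is_derive z e (onepole q v) (onepole1 q v z * e).
Proof.
move=> qz; have du := is_derive_geom e qz.
have -> : onepole q v =
    id - v *: (id * (cst 1 - id) * (fun y => (1 - q * y)^-1)) by [].
apply: is_derive_eq.
rewrite !fctE /onepole1 !scalerE_regular.
by field.
Qed.

Lemma is_derive_onepole1 q v z e : 1 - q * z != 0 ->
  is_derive z e (onepole1 q v) (onepole2 q v z * e).
Proof.
move=> qz; have du := is_derive_geom e qz.
pose u y := (1 - q * y)^-1.
have dp : is_derive z e (cst 1 - 2 *: id + q *: (id * id))
    (2 * (q * z - 1) * e).
  apply: (is_derive_eq (is_deriveD (is_deriveB _ (is_deriveZ _ _))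
                                   (is_deriveZ _ (is_deriveM _ _)))).
  by rewrite !scalerE_regular; ring.
have -> : onepole1 q v =
    cst 1 - v *: ((cst 1 - 2 *: id + q *: (id * id)) * (u * u)).
  by apply/funext => y; rewrite /onepole1 !fctE expr2 -exprVn expr2.
apply: (is_derive_eq (is_deriveB _ (is_deriveZ _
  (is_deriveM dp (is_deriveM du du))))).
by rewrite !fctE !scalerE_regular /onepole2 /=; field.
Qed.

(** A formula valid off the pole may be differentiated off the pole, that set
being open. The value at the pole itself is left unspecified. *)
Lemma is_derive_pole_free q z e (f g : K -> K) df :
    (forall y, 1 - q * y != 0 -> g y = f y) -> 1 - q * z != 0 ->
  is_derive z e f df -> is_derive z e g df.
Proof.
move=> gf qz; apply: near_eq_is_derive.
by apply: filterS (near_pole_free qz) => y /gf ->.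
Qed.

Lemma derive1_onepole q v z (f : K -> K) :
    (forall y, 1 - q * y != 0 -> f y = onepole q v y) -> 1 - q * z != 0 ->
  derive1 f z = onepole1 q v z.
Proof.
move=> fE qz; rewrite derive1E.
have df := is_derive_pole_free fE qz (is_derive_onepole v 1 qz).
by rewrite derive_val mulr1.
Qed.

(** The second derivative is a multiple of [(1 - q * z)^-3], and differentiating
such a power only raises the exponent. Starting the induction there avoids the
partial fraction decomposition, which would divide by [q]. *)
Lemma derive1n_onepole q v n z (f : K -> K) :
    (forall y, 1 - q * y != 0 -> f y = onepole q v y) -> 1 - q * z != 0 ->
  derive1n n.+2 f z =
    (n.+2)`!%:R * ((1 - q) * v * q ^+ n) / (1 - q * z) ^+ n.+3.
Proof.
move=> fE; elim: n z => [|n IH] z qz; rewrite derive1nS derive1E.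
  have df := is_derive_pole_free (fun y => derive1_onepole fE) qz
                                 (is_derive_onepole1 v 1 qz).
  by rewrite derive_val /onepole2 expr0 !mulr1 mulrA.
have df := is_derive_pole_free IH qz (is_derive_geomX _ n.+3 1 qz).
rewrite derive_val mulr1; congr (_ / _).
by rewrite [in RHS]factS natrM exprSr; ring.
Qed.

Lemma continuous_monom_geom c q z m k :
  1 - q * z != 0 ->
  {for z, continuous (fun y : K => c * y ^+ m / (1 - q * y) ^+ k : K)}.
Proof.
move=> qz; have dg := is_derive_geomX c k 1 qz.
apply/differentiable_continuous/derivable1_diffP.
have -> : (fun y => c * y ^+ m / (1 - q * y) ^+ k) =
    id ^+ m * (fun y => c / (1 - q * y) ^+ k).
  by apply/funext => y; rewrite !fctE mulrAC mulrC.
by apply: derivableM; [exact: derivableX|exact: ex_derive].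
Qed.

End OnePole.

Section OnePoleMorphism.
Variables (K L : numFieldType) (f : {rmorphism K -> L}).

Lemma onepole_morph (q v z : K) :
  f (onepole q v z) = onepole (f q) (f v) (f z).
Proof. by rewrite rmorphB !rmorphM fmorphV !rmorphB rmorphM rmorph1. Qed.

Lemma onepole1_morph (q v z : K) :
  f (onepole1 q v z) = onepole1 (f q) (f v) (f z).
Proof.
rewrite rmorphB rmorph1 rmorphM rmorphM fmorphV rmorphXn.
by congr (1 - _ * (_ / _ ^+ 2)); ring.
Qed.

Lemma onepole2_morph (q v z : K) :
  f (onepole2 q v z) = onepole2 (f q) (f v) (f z).
Proof.
by rewrite rmorphM fmorphV rmorphXn; congr (_ / _ ^+ 3); ring.
Qed.

End OnePoleMorphism.

(** * The complex plane and the unit circle *)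

Section ComplexPlane.
Variable R : realType.
Local Notation C := R[i].

Lemma normc_real (x : R) : `|x%:C| = `|x|%:C :> C.
Proof. by rewrite normc_def /= expr0n addr0 sqrtr_sqr. Qed.

Lemma gt0_complexE (e : C) : 0 < e -> e = (complex.Re e)%:C /\ 0 < complex.Re e.
Proof. by case: e => x y; rewrite ltcE/= => /andP[/eqP -> ->]. Qed.

Lemma real_complex_continuous : continuous (fun x : R => x%:C : C).
Proof.
move=> x; apply/(@cvgrPdist_lt _ _ _ (nbhs x)) => e /gt0_complexE[-> e0].
near=> y; rewrite -rmorphB normc_real ltcR.
by near: y; apply: cvgr_dist_lt e0; exact: cvg_id.
Unshelve. all: by end_near. Qed.

Lemma Re_continuous : continuous (@complex.Re R : C -> R).
Proof.
move=> z; apply/(@cvgrPdist_lt _ _ _ (nbhs z)) => e e0.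
have ec : 0 < e%:C by rewrite ltcR.
near=> y; rewrite -ltcR.
have -> : complex.Re z - complex.Re y = complex.Re (z - y).
  by case: (z) (y) => ? ? [].
by rewrite (le_lt_trans (normc_ge_Re _)).
Unshelve. all: by end_near. Qed.

Lemma conjc_affine (c x : R) (z : C) :
  (c%:C - x%:C * z)^*%C = c%:C - x%:C * z^*%C.
Proof. by rewrite rmorphB rmorphM; congr (_ - _ * _); exact: conjc_real. Qed.

Definition cis (t : R) : C := cos t +i* sin t.

Lemma polarE r t : polar r t = r%:C * cis t. Proof. by []. Qed.

Lemma norm_cis t : `|cis t| = 1.
Proof. by rewrite normc_def /= cos2Dsin2 sqrtr1. Qed.

Lemma mulcisJ t : cis t * (cis t)^*%C = 1.
Proof. by rewrite /cis /= -sqr_normc -add_Re2_Im2 /= cos2Dsin2. Qed.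

Lemma cis_neq0 t : cis t != 0.
Proof. by rewrite -normr_eq0 norm_cis oner_eq0. Qed.

Lemma conj_cis t : (cis t)^*%C = (cis t)^-1.
Proof. by apply: (mulfI (cis_neq0 t)); rewrite mulcisJ divff// cis_neq0. Qed.

Lemma cisX t n : cis t ^+ n = cis (n%:R * t) :> C.
Proof.
elim: n => [|n IH]; first by rewrite mul0r /cis cos0 sin0.
rewrite exprS IH -natr1 mulrDl mul1r addrC /cis cosD sinD; simpc.
by congr (_ +i* _); rewrite [RHS]addrC mulrC [X in _ + X]mulrC.
Qed.

Lemma cis2pi : cis (2 * pi) = 1 :> C.
Proof. by rewrite /cis mulr_natl cos2pi sin2pi. Qed.

Lemma cis_continuous : continuous cis.
Proof.
move=> t; have -> : cis = fun s => (cos s)%:C + 'i%C * (sin s)%:C.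
  by apply/funext => s; rewrite [LHS]complexE.
apply: cvgD; last apply: cvgMr.
- apply: continuous_comp; first exact: continuous_cos.
  exact: real_complex_continuous.
- apply: continuous_comp; first exact: continuous_sin.
  exact: real_complex_continuous.
Qed.

Lemma continuous_Re_cis (h : C -> C) :
  (forall t, {for cis t, continuous h}) ->
  continuous (fun t => complex.Re (h (cis t))).
Proof.
move=> ch t.
apply: (continuous_comp (f := h \o cis)); last exact: Re_continuous.
by apply: continuous_comp; [exact: cis_continuous|exact: ch].
Qed.

End ComplexPlane.

(** * Mean values over the unit circle *)

Section CircleMean.
Variable R : realType.
Local Notation C := R[i].
Local Notation mu := (@lebesgue_measure R).
Local Notation normc := (@ComplexField.Normc.normc R).
Implicit Types (f g : R -> R).

Let cint f : R := \int[mu]_(t in `[0, 2 * pi]) f t.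

Lemma two_pi_gt0 : 0 < 2 * pi :> R.
Proof. by rewrite mulr_gt0// pi_gt0. Qed.

Lemma continuous_integrable f : continuous f ->
  mu.-integrable `[0, 2 * pi] (EFin \o f).
Proof.
move=> cf; apply: continuous_compact_integrable; first exact: segment_compact.
exact: continuous_subspaceT.
Qed.

Lemma cintD f g : continuous f -> continuous g ->
  cint (fun t => f t + g t) = cint f + cint g.
Proof.
by move=> cf cg; apply: RintegralD => //; exact: continuous_integrable.
Qed.

Lemma cint_le f B : continuous f -> (forall t, `|f t| <= B) ->
  `|cint f| <= B * (2 * pi).
Proof.
move=> cf fB; have mI : measurable (`[0, 2 * pi]%classic : set R) by [].
apply: le_trans (le_normr_Rintegral _ (continuous_integrable cf)) _ => //.
have -> : B * (2 * pi) = cint (cst B).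
  rewrite /cint Rintegral_cst//= lebesgue_measure_itv/=.
  by rewrite lte_fin two_pi_gt0 sube0.
apply: le_Rintegral => //.
- by apply: continuous_integrable => t; apply: cvg_norm; exact: cf.
- by apply: continuous_integrable => t; exact: cvg_cst.
Qed.

Lemma cint_FTC f (F : R -> R) : continuous f ->
    (forall t : R, is_derive t (1 : R) F (f t)) ->
  cint f = F (2 * pi) - F 0.
Proof.
move=> cf dF; rewrite /cint /Rintegral (@continuous_FTC2 _ f F) ?two_pi_gt0//.
- exact: continuous_subspaceT.
- have cF : continuous F.
    by move=> t; apply/differentiable_continuous/derivable1_diffP/ex_derive.
  split.
  + by move=> t _; exact: ex_derive.
  + by apply: cvg_at_right_filter; exact: cF.
  + by apply: cvg_at_left_filter; exact: cF.
- by move=> t _; rewrite derive1E derive_val.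
Qed.

Lemma cint_cisX (c : C) n : (0 < n)%N ->
  cint (fun t => complex.Re (c * cis t ^+ n)) = 0.
Proof.
move=> n0; have nz : n%:R != 0 :> R by rewrite pnatr_eq0 -lt0n.
pose F (t : R) := n%:R^-1 * complex.Im (c * cis t ^+ n).
have -> : cint (fun t => complex.Re (c * cis t ^+ n)) = F (2 * pi) - F 0.
  apply: cint_FTC.
    apply: (@continuous_Re_cis R (fun z : C => c * z ^+ n : C)) => t.
    have -> : (fun z : C => c * z ^+ n) =
        (fun z => c * z ^+ n / (1 - 0 * z) ^+ 0).
      by apply/funext => z; rewrite expr0 divr1.
    by apply: continuous_monom_geom; rewrite mul0r subr0 oner_neq0.
  move=> t; case: c @F => x y F.
  have -> : F = n%:R^-1 *:
      (x *: (sin \o ( *%R n%:R)) + y *: (cos \o ( *%R n%:R))).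
    by apply/funext => s; rewrite /F cisX.
  have dn : is_derive t (1 : R) ( *%R n%:R) n%:R.
    have -> : *%R (n%:R : R) = n%:R *: id by [].
    by apply: is_derive_eq; rewrite scaler1.
  apply: (is_derive_eq (is_deriveZ _ (is_deriveD
    (is_deriveZ _ (is_derive1_comp _ dn))
    (is_deriveZ _ (is_derive1_comp _ dn))))).
  rewrite cisX /= !scalerE_regular.
  by field.
by rewrite /F cis2pi /cis cos0 sin0 subrr.
Qed.

Variable q : C.
Hypothesis q1 : `|q| < 1.

Lemma norm_geom_ge t : 1 - `|q| <= `|1 - q * cis t|.
Proof.
by rewrite -[X in X - _](normr1 C) -[`|q|]mulr1 -(norm_cis t) -normrM lerB_dist.
Qed.

Lemma geom_cis_neq0 t : 1 - q * cis t != 0.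
Proof. by rewrite -normr_gt0 (lt_le_trans _ (norm_geom_ge t))// subr_gt0. Qed.

Let term c m k t : R := complex.Re (c * cis t ^+ m / (1 - q * cis t) ^+ k).

Lemma continuous_term c m k : continuous (term c m k).
Proof.
apply: (@continuous_Re_cis R
  (fun z : C => c * z ^+ m / (1 - q * z) ^+ k : C)) => t.
by apply: continuous_monom_geom; exact: geom_cis_neq0.
Qed.

(** Insert [1 = (1 - q * z) + q * z] in the numerator. *)
Lemma cint_term_step c m k :
  cint (term c m k.+1) = cint (term c m k) + cint (term (q * c) m.+1 k.+1).
Proof.
rewrite -cintD; try exact: continuous_term.
congr cint; apply/funext => t; rewrite /term -raddfD/=; congr complex.Re.
have := geom_cis_neq0 t; move: (cis t) => z qz.
rewrite !exprS; field.
by rewrite qz expf_neq0.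
Qed.

Lemma cint_term_le c m k :
  `|cint (term c m k)| <= normc c / (1 - normc q) ^+ k * (2 * pi).
Proof.
have q0 : 0 < 1 - `|q| by rewrite subr_gt0.
apply: cint_le => [|t]; first exact: continuous_term.
rewrite -lecR (le_trans (normc_ge_Re _))//.
have -> : (normc c / (1 - normc q) ^+ k)%:C = `|c| / (1 - `|q|) ^+ k.
  by rewrite rmorphM fmorphV rmorphXn rmorphB.
rewrite normrM normfV normrM !normrX norm_cis expr1n mulr1.
apply: ler_wpM2l; first exact: normr_ge0.
rewrite lef_pV2 ?posrE ?exprn_gt0// ?normr_gt0 ?geom_cis_neq0//.
by apply: lerXn2r; rewrite ?nnegrE ?normr_ge0 ?norm_geom_ge// ltW.
Qed.

(** Induction on the order [k] of the pole. Once the means of order [k] vanish,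
[cint_term_step] trades a power of [z] for a factor [q] at order [k.+1]. After
[n] trades the mean is bounded by a constant times [|q|^n], hence it is zero. *)
Lemma cint_term_eq0 c m k : (0 < m)%N -> cint (term c m k) = 0.
Proof.
elim: k c m => [|k IH] c m m0.
  rewrite -(cint_cisX c m0); congr cint; apply/funext => t.
  by rewrite /term expr0 divr1.
have iter n : cint (term c m k.+1) = cint (term (q ^+ n * c) (m + n) k.+1).
  elim: n => [|n ->]; first by rewrite expr0 mul1r addn0.
  by rewrite cint_term_step IH ?addn_gt0 ?m0// add0r mulrA -exprS addnS.
pose r := normc q; pose B := normc c / (1 - r) ^+ k.+1 * (2 * pi).
have le n : `|cint (term c m k.+1)| <= geometric B r n.
  rewrite (iter n) (le_trans (cint_term_le _ _ _))//= ComplexField.Normc.normcM.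
  have -> : normc (q ^+ n) = r ^+ n.
    elim: n => [|n IHn]; first by rewrite !expr0 ComplexField.Normc.normc1.
    by rewrite !exprS ComplexField.Normc.normcM IHn.
  by rewrite [leLHS](_ : _ = B * r ^+ n)// /B /r; ring.
have /cvg_geometric cv : `|r| < 1.
  rewrite ger0_norm; first by rewrite -ltcR.
  by rewrite -ler0c; exact: (normr_ge0 q).
apply/eqP; rewrite -normr_le0.
rewrite -(cvg_lim (@Rhausdorff R) (cv B)).
by apply: limr_ge; [exact: cvgP (cv B)|exact: nearW].
Qed.

Lemma cint_term0 c k : cint (term c 0 k) = 2 * pi * complex.Re c.
Proof.
elim: k => [|k IH]; last by rewrite cint_term_step IH cint_term_eq0// addr0.
have -> : term c 0 0 = cst (complex.Re c).
  by apply/funext => t; rewrite /term !expr0 divr1 mulr1.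
rewrite /cint Rintegral_cst//= lebesgue_measure_itv/=.
by rewrite lte_fin two_pi_gt0 sube0/= mulrC.
Qed.

(** The mean value property of harmonic functions, for the real part of a
rational function whose only pole [1 / q] lies outside the closed disk. *)
Lemma mean_value (p : {poly C}) k :
  \int[mu]_(t in `[0, 2 * pi]) complex.Re (p.[cis t] / (1 - q * cis t) ^+ k) =
  2 * pi * complex.Re p.[0].
Proof.
rewrite horner_coef0.
pose S n t :=
  complex.Re ((\sum_(i < n) p`_i * cis t ^+ i) / (1 - q * cis t) ^+ k).
have S0 : S 0 = cst 0 by apply/funext => t; rewrite /S big_ord0 mul0r.
have SS n : S n.+1 = fun t => S n t + term p`_n n k t.
  by apply/funext => t; rewrite /S big_ord_recr/= mulrDl raddfD.
have cS n : continuous (S n).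
  elim: n => [|n IH]; first by rewrite S0 => t; exact: cvg_cst.
  by rewrite SS => t; apply: cvgD; [exact: IH|exact: continuous_term].
have cintS n : cint (S n.+1) = 2 * pi * complex.Re p`_0.
  elim: n => [|n IH]; rewrite SS cintD//; try exact: continuous_term.
    by rewrite cint_term0 S0 /cint Rintegral_cst// mul0r add0r.
  by rewrite IH cint_term_eq0// addr0.
rewrite -(cintS (size p)); congr cint; apply/funext => t.
by rewrite /S -horner_coef_wide.
Qed.

End CircleMean.

(** * Derivatives along a radius *)

Section Radial.
Variable R : realType.
Local Notation C := R[i].
Implicit Types (f : C -> C) (r t : R).

Lemma cvg_real_complex_punctured : (h%:C : C) @[h --> (0 : R)^'] --> (0 : C)^'.
Proof.
move=> A A0; have := @real_complex_continuous R 0 _ A0.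
apply: (@filterS _ (nbhs (0 : R))) => h /= Ah h0; apply: Ah.
by rewrite (inj_eq (@complexI R)).
Qed.

(** The difference quotient of [f] in the direction [cis t] converges along all
complex increments, in particular along the real ones, which describe the
radius. *)
Lemma is_derive_Re_polar f r t (df : C) :
  is_derive (polar r t) (cis t) f df ->
  is_derive r (1 : R) (fun s => complex.Re (f (polar s t))) (complex.Re df).
Proof.
move=> [fz dfE].
pose z := polar r t; pose u s := complex.Re (f (polar s t)).
have quot : (fun h : C => h^-1 *: ((f \o shift z) (h *: cis t) - f z)) @ 0^'
    --> df.
  by rewrite -dfE; exact: fz.
have cRe := @Re_continuous R df.
have cu := cvg_comp _ _ (cvg_comp _ _ (@cvg_real_complex_punctured) quot) cRe.
have uE : (fun h : R => h^-1 *: ((u \o shift r) (h *: 1) - u r)) @ 0^'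
    --> complex.Re df.
  move: cu; apply: cvg_trans; apply: near_eq_cvg; apply: nearW => h /=.
  have -> : h%:C *: cis t + z = polar (h *: 1 + r) t.
    by rewrite [h *: 1]mulr1 /z polarE -mulrDl -rmorphD.
  rewrite /u /z.
  by rewrite -fmorphV; case: (f _) (f _) => x y [x' y'] /=; rewrite mul0r subr0.
apply: DeriveDef; first exact: cvgP uE.
by apply: cvg_lim; first exact: norm_hausdorff.
Qed.

Lemma is_derive_Im_polar f r t (df : C) :
  is_derive (polar r t) (cis t) f df ->
  is_derive r (1 : R) (fun s => complex.Im (f (polar s t))) (complex.Im df).
Proof.
move=> dF.
have := @is_derive_Re_polar (- 'i%C *: f) r t (- 'i%C * df) (is_deriveZ _ dF).
have ReNi (z : C) : complex.Re (- 'i%C * z) = complex.Im z.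
  by rewrite mulNr mulrC raddfN/= ReiNIm opprK.
rewrite ReNi; congr is_derive; apply/funext => s; exact: ReNi.
Qed.

Lemma derive1_normc_polar f r t (df : C) :
  is_derive (polar r t) (cis t) f df ->
  (derive1 (fun s => ComplexField.Normc.normc (f (polar s t)) ^+ 2) r)%:C =
  (f (polar r t))^*%C * df + f (polar r t) * df^*%C.
Proof.
move=> dF; have dR := is_derive_Re_polar dF; have dI := is_derive_Im_polar dF.
have -> : (fun s => ComplexField.Normc.normc (f (polar s t)) ^+ 2) =
    (fun s => complex.Re (f (polar s t))) ^+ 2 +
    (fun s => complex.Im (f (polar s t))) ^+ 2.
  apply/funext => s; rewrite !fctE; case: (f _) => x y /=.
  by rewrite sqr_sqrtr// addr_ge0 ?sqr_ge0.
have dN := is_deriveD (is_deriveX 2 dR) (is_deriveX 2 dI).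
rewrite derive1E derive_val !scalerE_regular.
case: (f _) df {dF dR dI dN} => x y [x' y'] /=; simpc.
by congr (_ +i* _); ring.
Qed.

End Radial.

(** * The boundary integrand as the real part of an analytic function *)

Definition herglotz_den {K : pzRingType} (q : K) := (1 - q) ^+ 2 * (1 + q) ^+ 5.

(** Numerator of the analytic function [h] whose real part is the integrand. The
functional equation of [herglotz_identity] is a linear system for its six
coefficients, with [herglotz_den q] as a common denominator of the solution.
The solution is written here by powers of [v], and the factor [1 - z] reflects
that the integrand vanishes at [z = 1]. The ring is arbitrary so that the same
expression, read in a polynomial ring at ['X], is what [mean_value] expects. *)
Definition herglotz_num {K : comNzRingType} (q v z : K) : K :=
  (1 - z) *
   (2 * herglotz_den q * (1 - q * z) ^+ 4
    + v * herglotz_den q * ((1 - q * z) *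
        (- 10 + 6 * q + (8 + 12 * q - 6 * q ^+ 2) * z
         + (- 10 * q - 8 * q ^+ 2 + 2 * q ^+ 3) * z ^+ 2
         + (4 * q ^+ 2 + 2 * q ^+ 3) * z ^+ 3))
    + v ^+ 2 * (1 - q ^+ 2) *
        ((30 + 4 * q - 44 * q ^+ 2 - 24 * q ^+ 3 + 18 * q ^+ 4
          + 12 * q ^+ 5)
         + (- 10 - 96 * q - 20 * q ^+ 2 + 108 * q ^+ 3 + 74 * q ^+ 4
            - 28 * q ^+ 5 - 24 * q ^+ 6) * z
         + (6 + 36 * q + 116 * q ^+ 2 + 20 * q ^+ 3 - 110 * q ^+ 4
            - 88 * q ^+ 5 + 8 * q ^+ 6 + 16 * q ^+ 7) * z ^+ 2
         + (- 6 * q - 32 * q ^+ 2 - 68 * q ^+ 3 - 16 * q ^+ 4 + 58 * q ^+ 5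
            + 56 * q ^+ 6 + 8 * q ^+ 7 - 4 * q ^+ 8) * z ^+ 3
         + ((1 - q) * (1 + q) ^+ 4 * (2 * q ^+ 2 + 4 * q ^+ 3)) * z ^+ 4)
    + v ^+ 3 *
        ((- 6 + 30 * q + 6 * q ^+ 2 - 28 * q ^+ 3 - 14 * q ^+ 4 + 10 * q ^+ 5
          + 6 * q ^+ 6)
         + (18 + 40 * q - 90 * q ^+ 2 - 44 * q ^+ 3 + 54 * q ^+ 4 + 44 * q ^+ 5
            - 14 * q ^+ 6 - 12 * q ^+ 7) * z
         + (- 6 - 36 * q - 42 * q ^+ 2 + 100 * q ^+ 3 + 54 * q ^+ 4
            - 40 * q ^+ 5 - 46 * q ^+ 6 + 4 * q ^+ 7 + 8 * q ^+ 8) * z ^+ 2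
         + (6 * q + 24 * q ^+ 2 + 18 * q ^+ 3 - 48 * q ^+ 4 - 36 * q ^+ 5
            + 12 * q ^+ 6 + 26 * q ^+ 7 + 4 * q ^+ 8 - 2 * q ^+ 9) * z ^+ 3
         - (2 * q ^+ 2 * herglotz_den q) * z ^+ 4)).

Lemma herglotz_morph (K L : comNzRingType) (f : {rmorphism K -> L})
    (q v z : K) :
  f (herglotz_num q v z) = herglotz_num (f q) (f v) (f z).
Proof. by rewrite /herglotz_num /herglotz_den; ring. Qed.

Lemma herglotz_num_horner (K : comNzRingType) (x y z : K) :
  (herglotz_num x%:P y%:P 'X).[z] = herglotz_num x y z.
Proof.
have := herglotz_morph (horner_eval z) x%:P y%:P 'X.
by rewrite /= !horner_evalE !hornerC hornerX.
Qed.

(** Schwarz reflection at the circle turns the integrand into a rational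
function of [z] invariant under [z |-> z^-1]. Its poles lie at [q] and 0 inside
the disk and at [q^-1] and infinity outside, and [h] collects the outer ones. *)
Lemma herglotz_identity (K : numFieldType) (q v z : K) :
    z != 0 -> 1 - q * z != 0 -> 1 - q * z^-1 != 0 ->
  let F := onepole q v in
  let G z := z * onepole1 q v z in
  let H z := (onepole1 q v z + z * onepole2 q v z) * z in
  let h z := herglotz_num q v z / (1 - q * z) ^+ 4 in
  herglotz_den q * ((2 - F z - F z^-1) * (G z^-1 * H z + G z * H z^-1)) =
  h z + h z^-1.
Proof.
move=> z0 z1 z2 F G H h; rewrite /h /H /G /F /herglotz_num.
have z2' : z - q != 0.
  by have := mulf_neq0 z2 z0; rewrite mulrBl mulfVK// mul1r.
rewrite /herglotz_den /onepole /onepole1 /onepole2.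
by field; rewrite z0 z1 z2'.
Qed.

Section BoundaryFunctional.
Variables (R : realType) (q v : R) (F : R[i] -> R[i]).
Local Notation C := R[i].
Hypothesis q1 : `|q| < 1.
Hypothesis FE : forall z : C, 1 - q%:C * z != 0 -> F z = onepole q%:C v%:C z.

Let q1C : `|q%:C| < 1 :> C.
Proof. by rewrite normc_real ltcR. Qed.

Lemma onepole_conj z : (onepole q%:C v%:C z)^*%C = onepole q%:C v%:C z^*%C.
Proof.
by rewrite [LHS]onepole_morph; congr (onepole _ _ _); exact: conjc_real.
Qed.

Lemma onepole1_conj z : (onepole1 q%:C v%:C z)^*%C = onepole1 q%:C v%:C z^*%C.
Proof.
by rewrite [LHS]onepole1_morph; congr (onepole1 _ _ _); exact: conjc_real.
Qed.

Lemma onepole2_conj z : (onepole2 q%:C v%:C z)^*%C = onepole2 q%:C v%:C z^*%C.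
Proof.
by rewrite [LHS]onepole2_morph; congr (onepole2 _ _ _); exact: conjc_real.
Qed.

Lemma herglotz_num_conj (z : C) :
  (herglotz_num q%:C v%:C z)^*%C = herglotz_num q%:C v%:C z^*%C.
Proof.
rewrite -[in RHS](conjc_real q) -[in RHS](conjc_real v).
exact: (herglotz_morph (GRing.RMorphism.clone _ _ (@conjc R) _)).
Qed.

(** Since [zderiv F] is [z * onepole1 q v z], this is the product rule. *)
Lemma is_derive_zderiv (z e : C) : 1 - q%:C * z != 0 ->
  is_derive z e (zderiv F)
    ((onepole1 q%:C v%:C z + z * onepole2 q%:C v%:C z) * e).
Proof.
move=> qz; pose f y : C := y * onepole1 q%:C v%:C y.
have Ff y : 1 - q%:C * y != 0 -> zderiv F y = f y.
  by move=> qy; rewrite /zderiv (derive1_onepole FE).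
apply: (is_derive_pole_free Ff qz).
have df := is_derive_onepole1 v%:C e qz.
apply: (is_derive_eq (is_deriveM (is_derive_id z e) df)).
by rewrite !scalerE_regular; ring.
Qed.

Lemma radial_integrandE t :
  herglotz_den q * ((1 - complex.Re (F (polar 1 t))) *
    derive1 (fun s => ComplexField.Normc.normc (zderiv F (polar s t)) ^+ 2) 1) =
  complex.Re (herglotz_num q%:C v%:C (cis t) / (1 - q%:C * cis t) ^+ 4).
Proof.
have P1 : polar 1 t = cis t by rewrite polarE mul1r.
set z := cis t; have zJ : z^*%C = z^-1 by exact: conj_cis.
have qz : 1 - q%:C * z != 0 by exact: geom_cis_neq0.
have qzV : 1 - q%:C * z^-1 != 0.
  by rewrite -zJ -(conjc_affine 1) conjc_eq0.
pose f := onepole q%:C v%:C; pose g (y : C) := y * onepole1 q%:C v%:C y.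
pose g' (y : C) := (onepole1 q%:C v%:C y + y * onepole2 q%:C v%:C y) * y.
pose h (y : C) := herglotz_num q%:C v%:C y / (1 - q%:C * y) ^+ 4.
have fJ : (f z)^*%C = f z^-1 by rewrite -zJ; exact: onepole_conj.
have gJ : (g z)^*%C = g z^-1 by rewrite -zJ /g -onepole1_conj; exact: rmorphM.
have g'J : (g' z)^*%C = g' z^-1.
  rewrite -zJ /g' -onepole1_conj -onepole2_conj -rmorphM -rmorphD.
  exact: rmorphM.
have hJ : (h z)^*%C = h z^-1.
  have -> : h z^-1 = (herglotz_num q%:C v%:C z)^*%C / (1 - q%:C * z)^*%C ^+ 4.
    by rewrite herglotz_num_conj (conjc_affine 1) -zJ.
  by rewrite -rmorphXn -fmorphV; exact: rmorphM.
have onemC (x : R) : (1 - x)%:C = 1 - x%:C :> C by rewrite rmorphB.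
have ReF : (complex.Re (F (polar 1 t)))%:C = (f z + f z^-1) / 2 :> C.
  by rewrite P1 FE// ReJ_add -fJ.
have Reh : (complex.Re (h z))%:C = (h z + h z^-1) / 2 :> C.
  by rewrite ReJ_add hJ.
have dG : is_derive (polar 1 t) (cis t) (zderiv F) (g' z).
  by rewrite P1; exact: is_derive_zderiv.
have GE : zderiv F (polar 1 t) = g z by rewrite P1 /zderiv (derive1_onepole FE).
have := derive1_normc_polar dG; rewrite GE gJ g'J.
set D := derive1 _ _ => DE.
have id2 : herglotz_den q%:C *
    ((2 - f z - f z^-1) * (g z^-1 * g' z + g z * g' z^-1)) =
    h z + h z^-1 :> C.
  exact: (herglotz_identity v%:C (cis_neq0 t) qz qzV).
(* Both sides are real, hence may be compared as complex numbers. *)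
apply: (@complexI R); rewrite -/(h z) Reh -id2.
have KE : (herglotz_den q)%:C = herglotz_den q%:C :> C.
  by rewrite /herglotz_den rmorphM !rmorphXn rmorphB rmorphD.
have -> : (herglotz_den q * ((1 - complex.Re (F (polar 1 t))) * D))%:C =
   herglotz_den q%:C *
   ((1 - (f z + f z^-1) / 2) * (g z^-1 * g' z + g z * g' z^-1)) :> C.
  by rewrite -KE -DE -ReF -onemC -!rmorphM.
have half (K : numFieldType) (k x y d : K) :
    k * ((1 - (x + y) / 2) * d) = k * ((2 - x - y) * d) / 2 by field.
exact: half.
Qed.

Lemma herglotz_num_real (x y : R) :
  herglotz_num x%:C y%:C 0 = (herglotz_num x y 0)%:C :> C.
Proof. exact/esym/(herglotz_morph (real_complex R)). Qed.

Lemma calR_onepole : calR F = herglotz_num q v 0 / (2 * herglotz_den q).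
Proof.
have [q0 q2] : 1 - q != 0 /\ 1 + q != 0.
  move: q1; rewrite ltr_norml => /andP[qN1 qlt1].
  by split; apply: lt0r_neq0; lra.
have K0 : herglotz_den q != 0 by rewrite /herglotz_den mulf_neq0// expf_neq0.
pose p : {poly C} := herglotz_num (q%:C)%:P (v%:C)%:P 'X.
have int : \int[@lebesgue_measure R]_(t in `[0, 2 * pi])
    ((1 - complex.Re (F (polar 1 t))) * derive1 (fun s =>
       ComplexField.Normc.normc (zderiv F (polar s t)) ^+ 2) 1) =
    \int[@lebesgue_measure R]_(t in `[0, 2 * pi])
      complex.Re (((herglotz_den q)^-1%:C *: p).[cis t] /
                  (1 - q%:C * cis t) ^+ 4).
  apply: eq_Rintegral => t _; apply: (mulfI K0).
  rewrite radial_integrandE hornerZ herglotz_num_horner -mulrA.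
  move: (_ / _) => [x y] /=.
  by rewrite mul0r subr0 mulVKf.
rewrite /calR /radial_functional int (mean_value q1C) hornerZ.
rewrite herglotz_num_horner herglotz_num_real -rmorphM /=.
have pi0 : pi != 0 :> R by rewrite gt_eqF ?pi_gt0.
(* [field] is to treat the numerator, the denominator and [pi] as variables. *)
move: (herglotz_num q v 0) (herglotz_den q) (pi : R) K0 pi0 => n k x k0 x0.
by field; rewrite x0 k0.
Qed.

End BoundaryFunctional.

(** * The Cayley transform of a sum of two half-plane maps *)

(** The poles of [H] at 1 and [1 / a] cancel, and [H + 1] has the numerator
[2 * (1 - q * z)]. *)
Lemma cayley_Haw (K : numFieldType) (a w z : K) :
    1 - z != 0 -> 1 - a * z != 0 -> 1 - (1 - w + a * w) * z != 0 ->
  let H := w * ((1 + z) / (1 - z)) + (1 - w) * ((1 + a * z) / (1 - a * z)) in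
  (H - 1) / (H + 1) = onepole (1 - w + a * w) ((1 - w) * (1 - a)) z.
Proof.
move=> z1 az qz /=; rewrite /onepole.
have -> : w * ((1 + z) / (1 - z)) + (1 - w) * ((1 + a * z) / (1 - a * z)) + 1 =
    2 * (1 - (1 - w + a * w) * z) / ((1 - z) * (1 - a * z)).
  by field; rewrite ?z1 ?az.
by field; rewrite ?z1 ?az ?qz.
Qed.

(** [schur_gap] with the conjugate of [z] replaced by an indeterminate. Up to a
factor 4, this is [|H + 1|^2 - |H - 1|^2 = 4 Re H] for [H = Haw a w] multiplied
by the denominators, the two summands being the contributions to [Re H] of its
two terms. *)
Lemma schur_gap_ring (K : comNzRingType) (a' w' z zc : K) :
  let q' := 1 - w' + a' * w' in let b' := a' + w' - a' * w' in
  (1 - q' * z) * (1 - q' * zc) - z * (b' - a' * z) * (zc * (b' - a' * zc)) =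
  w' * (1 - z * zc) * ((1 - a' * z) * (1 - a' * zc)) +
  (1 - w') * (1 - a' ^+ 2 * (z * zc)) * ((1 - z) * (1 - zc)).
Proof. by rewrite /=; ring. Qed.

Section Faw.
Variables (R : realType) (a w : R).
Local Notation C := R[i].
Let q : R := 1 - w + a * w.
Let b : R := a + w - a * w.
Let v : R := (1 - w) * (1 - a).

Lemma Faw_frac (z : C) : 1 - q%:C * z != 0 -> Faw a w z = onepole q%:C v%:C z.
Proof.
move=> qz; apply: cvg_lim; first exact: norm_hausdorff.
have df := is_derive_onepole v%:C 1 qz.
have cf : onepole q%:C v%:C y @[y --> z^'] --> onepole q%:C v%:C z.
  apply: cvg_within_filter; apply: differentiable_continuous.
  by apply/derivable1_diffP.
apply: cvg_trans cf; apply: near_eq_cvg.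
near=> y; rewrite /Haw.
have y1 : 1 - y != 0.
  by rewrite -[y]mul1r; near: y; exact: near_punctured_pole_free.
have ya : 1 - a%:C * y != 0 by near: y; exact: near_punctured_pole_free.
have yq : 1 - q%:C * y != 0 by near: y; exact: near_punctured_pole_free.
have qE : q%:C = 1 - w%:C + a%:C * w%:C :> C by rewrite rmorphD rmorphB rmorphM.
have vE : v%:C = (1 - w%:C) * (1 - a%:C) :> C by rewrite rmorphM !rmorphB.
have wE : (1 - w)%:C = 1 - w%:C by rewrite rmorphB.
by rewrite /= wE cayley_Haw// -?qE// -vE.
Unshelve. all: by end_near. Qed.

Lemma schur_gap (z : C) :
  `|1 - q%:C * z| ^+ 2 - `|z * (b%:C - a%:C * z)| ^+ 2 =
  w%:C * (1 - `|z| ^+ 2) * `|1 - a%:C * z| ^+ 2 +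
  (1 - w)%:C * (1 - (a ^+ 2)%:C * `|z| ^+ 2) * `|1 - z| ^+ 2.
Proof.
have wE : (1 - w)%:C = 1 - w%:C :> C by rewrite rmorphB.
have qE : q%:C = 1 - w%:C + a%:C * w%:C :> C by rewrite rmorphD rmorphB rmorphM.
have bE : b%:C = a%:C + w%:C - a%:C * w%:C :> C.
  by rewrite rmorphB rmorphD rmorphM.
have conj1 x : (1 - x%:C * z)^*%C = 1 - x%:C * z^*%C.
  exact: conjc_affine 1 x z.
have conjb : (z * (b%:C - a%:C * z))^*%C = z^*%C * (b%:C - a%:C * z^*%C).
  by rewrite rmorphM; congr (_ * _); exact: conjc_affine.
have conjz : (1 - z)^*%C = 1 - z^*%C by rewrite rmorphB rmorph1.
rewrite !sqr_normc conjb conjz !conj1.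
rewrite wE bE qE (_ : (a ^+ 2)%:C = a%:C ^+ 2); last exact: rmorphXn.
exact: schur_gap_ring.
Qed.

Hypotheses (ha : -1 < a < 1) (hw : 0 < w < 1).

Lemma q_ltr1 : `|q| < 1.
Proof.
move: ha hw => /andP[a1 a2] /andP[w1 w2].
by rewrite ltr_norml /q; apply/andP; split; nra.
Qed.

Lemma closed_disk_pole_free (z : C) : `|z| <= 1 -> 1 - q%:C * z != 0.
Proof.
move=> z1; rewrite subr_eq0; apply: contraTneq isT => e.
have : `|q%:C * z| < 1 :> C.
  rewrite normrM normc_real.
  by rewrite (le_lt_trans (ler_piMr _ z1))// ?lecR ?ltcR ?q_ltr1.
by rewrite -e normr1 ltxx.
Qed.

Lemma FawE (z : C) : 1 - q%:C * z != 0 ->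
  Faw a w z = z * ((b%:C - a%:C * z) / (1 - q%:C * z)).
Proof.
move=> qz; rewrite Faw_frac// /onepole.
have vE : v%:C = 1 - b%:C :> C.
  rewrite -(rmorph1 (real_complex R)) -rmorphB; congr (_%:C).
  by rewrite /v /b; ring.
have aE : a%:C = q%:C + b%:C - 1 :> C.
  rewrite -(rmorph1 (real_complex R)) -rmorphD -rmorphB; congr (_%:C).
  by rewrite /q /b; ring.
move: qz; rewrite vE aE; move: (q%:C) (b%:C) => Q B qz.
by field.
Qed.

Lemma Faw_derivable (z : C) : 1 - q%:C * z != 0 -> derivable (Faw a w) z 1.
Proof.
move=> qz.
have df := is_derive_pole_free Faw_frac qz (is_derive_onepole v%:C 1 qz).
exact: ex_derive.
Qed.

Lemma Faw_schur : schur (Faw a w).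
Proof.
move: ha hw => /andP[a1 a2] /andP[w1 w2].
split=> z /= z1; first exact/Faw_derivable/closed_disk_pole_free/ltW.
have qz := closed_disk_pole_free (ltW z1).
rewrite FawE// mulrA normrM normfV ler_pdivrMr ?normr_gt0// mul1r.
rewrite -(@ler_pXn2r _ 2)// ?nnegrE// -subr_ge0 schur_gap.
have zz : `|z| ^+ 2 <= 1 by rewrite expr_le1// ltW.
rewrite addr_ge0// !mulr_ge0 ?exprn_ge0 ?subr_ge0// ?ler0c ?subr_ge0 ?ltW//.
by rewrite (le_lt_trans (ler_piMr _ zz))// ?ler0c ?sqr_ge0// ltcR expr2; nra.
Qed.

Lemma Faw_analytic_near : analytic_near_closed_disk (Faw a w).
Proof.
exists [set z | 1 - q%:C * z != 0]; split; first exact: open_pole_free.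
- exact: closed_disk_pole_free.
- by move=> z /= /Faw_derivable.
Qed.

Lemma Faw0 : Faw a w 0 = 0.
Proof. by rewrite FawE ?mul0r// mulr0 subr0 oner_neq0. Qed.

Lemma Faw1 : Faw a w 1 = 1.
Proof.
have q1 : 1 - q%:C * 1 != 0 :> C by rewrite closed_disk_pole_free// normr1.
by rewrite Faw_frac// /onepole subrr mulr0 mul0r mulr0 subr0.
Qed.

Lemma Faw_taylor1 : taylor_coef 1 (Faw a w) = b%:C.
Proof.
have q0 : 1 - q%:C * 0 != 0 :> C by rewrite mulr0 subr0 oner_neq0.
rewrite /taylor_coef /= divr1 (derive1_onepole Faw_frac)// /onepole1.
rewrite expr0n !mulr0 !subr0 addr0 expr1n divr1 mulr1.
rewrite -(rmorph1 (real_complex R)) -rmorphB; congr (_%:C).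
by rewrite /v /b; ring.
Qed.

Lemma Faw_taylor n : (2 <= n)%N ->
  taylor_coef n (Faw a w) = (w * (1 - w) * (1 - a) ^+ 2 * q ^+ (n - 2))%:C.
Proof.
case: n => [//|[//|n]] _.
have q0 : 1 - q%:C * 0 != 0 :> C by rewrite mulr0 subr0 oner_neq0.
rewrite /taylor_coef (derive1n_onepole _ Faw_frac)// mulr0 subr0 expr1n divr1.
rewrite mulrC mulKf ?pnatr_eq0 ?gtn_eqF ?fact_gt0// subn2 /= -rmorphXn.
rewrite -(rmorph1 (real_complex R)) -rmorphB -!rmorphM; congr (_%:C).
rewrite (_ : 1 - q = w * (1 - a)); last by rewrite /q; ring.
by congr (_ * _); rewrite /v; ring.
Qed.

Lemma Faw_lt1 (z : C) : `|z| = 1 -> z != 1 -> `|Faw a w z| < 1.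
Proof.
move: ha hw => /andP[a1 a2] /andP[w1 w2] z1 zn1.
have nz : 1 - z != 0 by rewrite subr_eq0 eq_sym.
have qz : 1 - q%:C * z != 0 by rewrite closed_disk_pole_free// z1.
rewrite FawE// mulrA normrM normfV ltr_pdivrMr ?normr_gt0// mul1r.
rewrite -(@ltr_pXn2r _ 2)// ?nnegrE// -subr_gt0 schur_gap z1 expr1n subrr.
rewrite mulr0 mul0r add0r mulr1 !mulr_gt0 ?exprn_gt0 ?normr_gt0//.
- by rewrite ltcR subr_gt0.
- by rewrite subr_gt0 ltcR expr2; nra.
Qed.

Lemma Faw_radial (t : R) :
  Faw a w (polar r t) @[r --> 1^'-] --> Faw a w (cis t).
Proof.
have qt : 1 - q%:C * cis t != 0 by rewrite closed_disk_pole_free// norm_cis.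
have cF : {for cis t, continuous (Faw a w)}.
  by apply/differentiable_continuous/derivable1_diffP/Faw_derivable.
apply: cvg_at_left_filter.
have cP : polar r t @[r --> (1 : R)] --> cis t.
  rewrite -[cis t in X in _ --> X]mul1r; apply: cvgMl.
  exact: (@real_complex_continuous R 1).
exact: cvg_comp cP cF.
Qed.

(** By continuity the radial limit at [cis t] is [F (cis t)], of modulus less
than 1 for all [t] in [`]0, pi[]. *)
Lemma Faw_not_inner : ~ inner (Faw a w).
Proof.
case=> _ [N [mN N0 bad]].
have sub : `]0, pi[%classic `<=` N.
  move=> t /=; rewrite in_itv/= => /andP[t0 tpi]; apply: bad => /= inner_t.
  have [|l Fl l1] := inner_t.
    rewrite in_itv/= (ltW t0)/= (le_trans (ltW tpi))//.
    by rewrite ler_peMl ?pi_ge0// ler1n.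
  have lE : l = Faw a w (cis t).
    have hC : hausdorff_space C by exact: norm_hausdorff.
    by rewrite -(cvg_lim hC Fl) (cvg_lim hC (@Faw_radial t)).
  have : `|l| < 1.
    rewrite lE Faw_lt1 ?norm_cis//.
    apply/eqP => /(congr1 (@complex.Im R))/= sint0.
    by have := sin_gt0_pi (x := t); rewrite t0 tpi sint0 ltxx => /(_ isT).
  by rewrite l1 ltxx.
have : (lebesgue_measure `]0%R, pi[%classic <= lebesgue_measure N)%E.
  by apply: le_measure; rewrite ?inE.
rewrite N0 lebesgue_measure_itv /= lte_fin pi_gt0 sube0 lee_fin.
by rewrite leNgt pi_gt0.
Qed.

Lemma herglotz_num_Paw : herglotz_num q v 0 = 2 * (1 - a) ^+ 2 * Paw a w.
Proof. by rewrite /q /v /herglotz_num /herglotz_den /Paw; ring. Qed.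

Lemma calR_Faw :
  calR (Faw a w) = Paw a w / (w ^+ 2 * (2 - w + a * w) ^+ 5).
Proof.
rewrite (calR_onepole q_ltr1 Faw_frac).
rewrite herglotz_num_Paw.
move: ha hw => /andP[a1 a2] /andP[w1 w2].
have -> : herglotz_den q = (1 - a) ^+ 2 * (w ^+ 2 * (2 - w + a * w) ^+ 5).
  by rewrite /herglotz_den /q; ring.
have wn0 : w != 0 by rewrite gt_eqF.
have an0 : 1 - a != 0 by rewrite subr_eq0 gt_eqF.
have qn0 : 2 - w + a * w != 0 by apply: lt0r_neq0; nra.
by field; rewrite wn0 an0 qn0.
Qed.

End Faw.

(** * Positivity *)

Ltac nonneg :=
  match goal with
  | |- is_true (0 <= _ + _) => apply: addr_ge0; nonneg
  | |- is_true (0 <= _ * _) => apply: mulr_ge0; nonneg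
  | |- is_true (0 <= (_ - _) ^+ 2) => exact: sqr_ge0
  | |- is_true (0 <= _ ^+ _) => apply: exprn_ge0; nonneg
  | |- is_true (0 <= _%:R) => exact: ler0n
  | _ => assumption
  end.

(** The numbers [1 + a], [(1 - a) * (1 - w)] and [(1 - a) * w] are barycentric
coordinates, of sum 2, of the triangle of admissible parameters. In them
[(1 - a) ^+ 2 * Paw a w] becomes a form of degree 9 with five negative
coefficients, and each of these is absorbed in the square of a binomial. The
identity below is that decomposition divided by [(1 - a) ^+ 2]. The factor 128
clears the denominators coming from the sum 2. *)
Lemma Paw_gt0 (R : realType) (a w : R) : -1 < a < 1 -> 0 < w < 1 -> 0 < Paw a w.
Proof.
move=> /andP[aN1 a1] /andP[w0 w1].
pose u := 1 + a; pose s := 1 - a; pose v := 1 - w.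
have u0 : 0 < u by rewrite /u; lra.
have s0 : 0 < s by rewrite subr_gt0.
have v0 : 0 < v by rewrite subr_gt0.
suff : 0 < 128 * Paw a w by rewrite pmulr_rgt0.
have -> : 128 * Paw a w =
   4 * s ^+ 7 * v ^+ 9
   + ((u ^+ 5 * (u * w - 4 * s * v ^+ 2) ^+ 2
      + u ^+ 3 * w ^+ 2 * (2 * u ^+ 2 - 10 * s ^+ 2 * v ^+ 2) ^+ 2
      + u ^+ 3 * w ^+ 2 * (4 * u ^+ 2 - 16 * s ^+ 2 * v * w) ^+ 2
      + s * u ^+ 2 * v * w ^+ 2 * (6 * u ^+ 2 - 19 * s ^+ 2 * v ^+ 2) ^+ 2
      + 40 * s * u ^+ 2 * v * w ^+ 2 * (u ^+ 2 - 5 * s ^+ 2 * v * w) ^+ 2)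
   + s ^+ 7 * (4 * v ^+ 3 * w ^+ 6 + 40 * v ^+ 4 * w ^+ 5
      + 252 * v ^+ 5 * w ^+ 4 + 432 * v ^+ 6 * w ^+ 3 + 252 * v ^+ 7 * w ^+ 2
      + 40 * v ^+ 8 * w)
   + s ^+ 6 * u * (24 * v ^+ 2 * w ^+ 6 + 192 * v ^+ 3 * w ^+ 5
      + 1096 * v ^+ 4 * w ^+ 4 + 1664 * v ^+ 5 * w ^+ 3 + 904 * v ^+ 6 * w ^+ 2
      + 192 * v ^+ 7 * w + 24 * v ^+ 8)
   + s ^+ 5 * u ^+ 2 * (152 * v ^+ 2 * w ^+ 5 + 532 * v ^+ 3 * w ^+ 4
      + 2080 * v ^+ 4 * w ^+ 3 + 703 * v ^+ 5 * w ^+ 2 + 360 * v ^+ 6 * w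
      + 60 * v ^+ 7)
   + s ^+ 4 * u ^+ 3 * (560 * v ^+ 2 * w ^+ 4 + 640 * v ^+ 3 * w ^+ 3
      + 188 * v ^+ 4 * w ^+ 2 + 320 * v ^+ 5 * w + 80 * v ^+ 6)
   + s ^+ 3 * u ^+ 4 * (160 * v * w ^+ 4 + 120 * v ^+ 4 * w + 60 * v ^+ 5)
   + s ^+ 2 * u ^+ 5 * (32 * w ^+ 4 + 8 * v ^+ 4)
   + s * u ^+ 6 * (64 * w ^+ 3 + 20 * v * w ^+ 2 + 4 * v ^+ 3)
   + 11 * u ^+ 7 * w ^+ 2).
  rewrite /Paw /u /s /v; ring.
have [u1 s1 v1 w2] : [/\ 0 <= u, 0 <= s, 0 <= v & 0 <= w] by split; exact: ltW.
apply: ltr_pwDl; last nonneg.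
by rewrite mulr_gt0 ?mulr_gt0 ?exprn_gt0.
Qed.

Theorem theorem3p15 (R : realType) (a w : R)
    (ha : -1 < a < 1) (hw : 0 < w < 1) :
  let F : R[i] -> R[i] := Faw a w in
  let q : R := 1 - w + a * w in
  let b : R := a + w - a * w in
  let d : R := w * (1 - w) * (1 - a) ^+ 2 in
  [/\ schur F, ~ inner F, F 0 = 0 & F 1 = 1] /\
  (analytic_near_closed_disk F /\ 0 < calR F) /\
  [/\ forall z : R[i], 1 - q%:C * z != 0 ->
        F z = z * ((b%:C - a%:C * z) / (1 - q%:C * z)),
      taylor_coef 1 F = b%:C,
      forall n : nat, (2 <= n)%N ->
        taylor_coef n F = (d * q ^+ (n - 2))%:C &
      calR F = Paw a w / (w ^+ 2 * (2 - w + a * w) ^+ 5)].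
Proof.
move=> F q b d; split; last split.
- split; [exact: Faw_schur|exact: Faw_not_inner|exact: Faw0|exact: Faw1].
- split; first exact: Faw_analytic_near.
  rewrite calR_Faw// divr_gt0 ?Paw_gt0//.
  move: ha hw => /andP[a1 a2] /andP[w1 w2].
  by rewrite mulr_gt0// exprn_gt0//; nra.
- split; [exact: FawE|exact: Faw_taylor1|exact: Faw_taylor|exact: calR_Faw].
Qed.
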